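(* Let $d\in\mathbb{N}$, $d\ge1$, let $p>0$ and let $(X_t)_{t\in[0,1]^d}$ be a process such that $X_t\in\mathbb{L}^p$ for all $t\in[0,1]^d$. Assume that there exist positive constants $C$ and $\varepsilon$ such that $$\mathbb{E}[|X_t-X_s|^p]\le C|t-s|^{d+\varepsilon}\qquad\text{for all } s,t\in[0,1]^d.$$ Then $X$ admits a modification $\tilde X$ (i.e. a process $(\tilde X_t)_{t\in[0,1]^d}$ with $\tilde X_t=X_t$ q.s. for every $t\in[0,1]^d$) such that $$\mathbb{E}\left[\left(\sup_{s\ne t}\frac{|\tilde X_t-\tilde X_s|}{|t-s|^\alpha}\right)^p\right]<\infty$$ for every $\alpha\in[0,\varepsilon/p)$. As a consequence, the paths of $\tilde X$ are quasi-surely Hölder continuous of order $\alpha$ for every $\alpha<\varepsilon/p$, in the sense that there exists a Borel set $N$ of capacity $0$ such that for all $w\in N^c$ the map $t\mapsto\tilde X_t(w)$ is Hölder continuous of order $\alpha$ for every $\alpha<\varepsilon/p$. Moreover, if $X_t\in\mathbb{L}^p_c$ for each $t$, then also $\tilde X_t\in\mathbb{L}^p_c$ for each $t$.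
   Context: $\Omega$ is a complete separable metric space with Borel $\sigma$-algebra $\mathscr{B}(\Omega)$, and $\mathscr{P}$ is a given nonempty set of probability measures on $(\Omega,\mathscr{B}(\Omega))$. $L^0(\Omega)$ is the space of real Borel functions on $\Omega$, and $C_b(\Omega)$ the bounded continuous ones. For $A\in\mathscr{B}(\Omega)$, its capacity is $c(A):=\sup_{P\in\mathscr{P}}P(A)$. A Borel set $A$ is polar if $c(A)=0$, and a property holds quasi-surely (q.s.) if it holds outside a polar set. For $X\in L^0(\Omega)$ such that $E_P[X]$ exists for each $P\in\mathscr{P}$, $\mathbb{E}[X]:=\sup_{P\in\mathscr{P}}E_P[X]$. For $p>0$, $\mathcal{L}^p=\{X\in L^0(\Omega):\mathbb{E}[|X|^p]<\infty\}$, $\mathcal{N}=\{X\in L^0(\Omega):X=0\text{ q.s.}\}$, $\mathbb{L}^p=\mathcal{L}^p/\mathcal{N}$ (classes are not distinguished from representatives). $\mathbb{L}^p$ carries the norm $\|X\|_p=(\mathbb{E}[|X|^p])^{1/p}$ if $p\ge1$ and the metric $d(X,Y)=\mathbb{E}[|X-Y|^p]$ if $p<1$; it is complete. $\mathbb{L}^p_c$ is the completion of $C_b(\Omega)$ with respect to this distance, i.e. the closure in $\mathbb{L}^p$ of (the image of) $C_b(\Omega)$. *)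

(* Defs.v *)
From HB Require Import structures.
From mathcomp Require Import all_boot all_order all_algebra.
From mathcomp Require Import all_classical all_reals all_analysis.
From mathcomp Require Import measurable_realfun.
Set Implicit Arguments.
Unset Strict Implicit.
Unset Printing Implicit Defensive.
Import Order.TTheory GRing.Theory Num.Theory.
Import numFieldNormedType.Exports.
Local Open Scope classical_set_scope.
Local Open Scope ring_scope.

(* Complete metric spaces.  [Complete] carries a base point; this loses no
   generality below, where the space supports a probability measure. *)
#[short(type="completeMetricType")]
HB.structure Definition CompleteMetric (R : numDomainType) :=
  {T of Metric R T & Complete T}.

Definition separable (T : topologicalType) : Prop :=
  exists2 D : set T, countable D & dense D.

Notation borel T := (g_sigma_algebraType (@open T)).

Section sublinear_expectation.
Context {R : realType} {Omega : completeMetricType R}.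
Variable PP : set (probability (borel Omega) R).
Local Open Scope ereal_scope.

Definition capacity (A : set (borel Omega)) : \bar R :=
  ereal_sup [set P A | P in PP].

Definition polar (A : set (borel Omega)) : Prop :=
  measurable A /\ capacity A = 0.

Definition qs (Q : Omega -> Prop) : Prop :=
  exists2 N, polar N & forall w, ~ N w -> Q w.

(* Only applied to nonnegative measurable functions, so that every integral
   exists; \bar R-valued because it is also applied to a supremum. *)
Definition upper_expectation (X : borel Omega -> \bar R) : \bar R :=
  ereal_sup [set \int[P]_w X w | P in PP].

(* The spaces below are sets of representatives: they are saturated for
   quasi-sure equality of Borel functions, so membership of a class is
   membership of any of its representatives. *)
Definition Lp (p : R) : set (Omega -> R) :=
  [set X : Omega -> R | measurable_fun [set: borel Omega] X /\
           upper_expectation (fun w => (`|X w| `^ p)%R%:E) < +oo].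

Definition Lp_dist (p : R) (X Y : Omega -> R) : \bar R :=
  let m := upper_expectation (fun w => (`|X w - Y w| `^ p)%R%:E) in
  if (1 <= p)%R then m `^ p^-1 else m.

Definition Cb : set (Omega -> R) :=
  [set f : Omega -> R | continuous f /\ [bounded f w | w in setT]].

(* closure of Cb in Lp for the distance Lp_dist *)
Definition Lpc (p : R) : set (Omega -> R) :=
  [set X : Omega -> R | Lp p X /\
    forall e : R, (0 < e)%R -> exists2 f, Cb f & Lp_dist p X f < e%:E].

End sublinear_expectation.

Section paths.
Context {R : realType} {d : nat}.
Implicit Types (t s v : 'rV[R]_d) (f : 'rV[R]_d -> R) (a : R).

(* The library norm on 'rV[R]_d is the sup norm. *)
Definition enorm v : R := Num.sqrt (\sum_(i < d) v 0 i ^+ 2).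

Definition unit_cube : set 'rV[R]_d := [set t | forall i, 0 <= t 0 i <= 1].

Definition holder_quotient_sup a f : \bar R :=
  ereal_sup [set r | exists s t, [/\ unit_cube s, unit_cube t, s <> t &
                     r = (`|f t - f s| / enorm (t - s) `^ a)%:E]].

Definition holder_on_cube a f : Prop :=
  exists K : R, forall s t, unit_cube s -> unit_cube t ->
    `|f t - f s| <= K * enorm (t - s) `^ a.

End paths.

(* Main.v *)
(* Kolmogorov's chaining argument, run with one random variable per exponent.
   Round t down to a point t_n of the dyadic grid of mesh 2^-n.  Let S_n be the
   sum of |X_u - X_v|^p over pairs of neighbouring points of that grid: there
   are at most 6^d 2^(nd) of them, so E[S_n] = O(2^(-n eps)), and
   G_b = sum_n 2^(nbp) S_n has finite upper expectation for every b < eps/p.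
   Where G_b is finite, neighbouring increments at level n are at most
   G_b^(1/p) 2^(-nb).  Now t_n and t_(n+1) are neighbours at level n+1, and so
   are s_n and t_n at level n when |s - t| <= 2^-n.  Hence the limit of X_(t_n)
   exists and is b-Hoelder with constant c_b G_b^(1/p).  This yields the moment
   bound for every p > 0 at once, without Minkowski's inequality.  Finally
   sum_n E[|X_(t_n) - X_t|^p] < oo forces X_(t_n) -> X_t quasi-surely, so the
   limit is a modification. *)
Require Import Defs.
From HB Require Import structures.
From mathcomp Require Import all_boot all_order all_algebra.
From mathcomp Require Import all_classical all_reals all_analysis.
From mathcomp Require Import measurable_realfun.
From mathcomp Require Import lra ring zify.
Import Order.TTheory GRing.Theory Num.Theory.
Import numFieldNormedType.Exports.
Local Open Scope classical_set_scope.
Local Open Scope ring_scope.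

Set Implicit Arguments.
Unset Strict Implicit.
Unset Printing Implicit Defensive.

(** * Geometry of the dyadic grids of the unit cube *)

Section dyadic_grid.
Context {R : realType} {d : nat}.
Implicit Types (n m : nat) (s t v : 'rV[R]_d) (f : 'rV[R]_d -> R).

Local Notation grid_index n := {ffun 'I_d -> 'I_(2 ^ n).+1}.

Definition grid_point n (k : grid_index n) : 'rV[R]_d :=
  \row_i ((k i)%:R / 2 ^+ n).

(* Coordinate i moves by e i - 1, clipped to the grid (the truncated .-1 clips
   at 0). *)
Definition neighbour n (k : grid_index n) (e : {ffun 'I_d -> 'I_3}) :
    grid_index n :=
  [ffun i => inord (minn (k i + e i).-1 (2 ^ n))%N].

Definition adjacent n (k l : grid_index n) : Prop :=
  forall i, (k i <= (l i).+1)%N /\ (l i <= (k i).+1)%N.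

Definition refine n (k : grid_index n) : grid_index n.+1 :=
  [ffun i => inord (k i).*2].

(** A coordinate equal to 1 rounds to 2^n, which is why indices range over ['I_(2 ^ n).+1]. On the
    cube [inord] therefore never falls back to its default value. *)
Definition round_index n t : grid_index n :=
  [ffun i => inord (Num.truncn (2 ^+ n * t 0 i))].

Definition dyadic_round n t : 'rV[R]_d := grid_point (round_index n t).

Lemma grid_point_cube n (k : grid_index n) : unit_cube (grid_point k).
Proof.
move=> i; rewrite mxE divr_ge0//= ler_pdivrMr ?exprn_gt0// mul1r.
by rewrite -natrX ler_nat -ltnS.
Qed.

(** Turns the geometric relation into one of the 3^d enumerated moves, over which the moments are
    summed later. *)
Lemma adjacent_neighbour n (k l : grid_index n) :
  adjacent k l -> exists e, neighbour k e = l.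
Proof.
move=> kl; exists [ffun i => inord (l i + 1 - k i)%N]; apply/ffunP => i.
have [kli lki] := kl i; have li := ltn_ord (l i).
have e3 : (l i + 1 - k i < 3)%N by lia.
apply: val_inj; rewrite !ffunE /= (inordK e3) subnKC ?addn1//.
by rewrite inordK ?ltnS ?geq_minr//; lia.
Qed.

(** Before clipping a coordinate moves by -1, 0 or 1 mesh, and clipping can only shorten the
    move. *)
Lemma neighbour_dist n (k : grid_index n) e i :
  `|(grid_point (neighbour k e) - grid_point k) 0 i| <= (2 ^+ n)^-1.
Proof.
rewrite !mxE -mulrBl normrM [X in _ * X]ger0_norm ?invr_ge0 ?exprn_ge0//.
rewrite ler_piMl ?invr_ge0 ?exprn_ge0// ffunE inordK; last first.
  by rewrite ltnS geq_minr.
have ki := ltn_ord (k i); have ei := ltn_ord (e i).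
set m := minn _ _.
have : (m%:R <= (k i).+1%:R :> R) by rewrite ler_nat /m; lia.
have : ((k i)%:R <= m.+1%:R :> R) by rewrite ler_nat /m; lia.
rewrite -!natr1 ler_norml; lra.
Qed.

Lemma val_refine n (k : grid_index n) i : refine k i = (k i).*2 :> nat.
Proof. by rewrite ffunE inordK// ltnS -mul2n expnS leq_mul2l /= -ltnS. Qed.

Lemma grid_point_refine n (k : grid_index n) :
  grid_point (refine k) = grid_point k.
Proof.
apply/rowP => i; rewrite !mxE val_refine exprS -mul2n natrM; field.
by rewrite expf_neq0.
Qed.

Lemma val_round_index n t i : unit_cube t ->
  round_index n t i = Num.truncn (2 ^+ n * t 0 i) :> nat.
Proof.
move=> /(_ i)/andP[t0 t1]; rewrite ffunE inordK// ltnS.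
rewrite truncn_le_nat -[X in _ < X]natr1 natrX.
have : 2 ^+ n * t 0 i <= 2 ^+ n by rewrite ler_piMr ?exprn_ge0.
lra.
Qed.

Lemma round_index_itv n t i : unit_cube t ->
  (round_index n t i)%:R <= 2 ^+ n * t 0 i < (round_index n t i)%:R + 1.
Proof.
move=> t01; rewrite val_round_index// natr1 truncn_itv//.
by rewrite mulr_ge0 ?exprn_ge0//; case/andP: (t01 i).
Qed.

Lemma dyadic_round_dist n t i : unit_cube t ->
  `|(dyadic_round n t - t) 0 i| <= (2 ^+ n)^-1.
Proof.
move=> /round_index_itv -/(_ n i)/andP[le1 lt2].
have p0 : 0 < 2 ^+ n :> R by rewrite exprn_gt0.
rewrite !mxE -(ler_pM2l p0) -{1}(gtr0_norm p0) -normrM mulrBr mulrCA.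
by rewrite !mulfV ?gt_eqF// mulr1 ler_norml; lra.
Qed.

(** After scaling by 2^n: two reals at distance at most 1 have integer parts that differ by at most
    1. *)
Lemma adjacent_round n s t : unit_cube s -> unit_cube t ->
  (forall i, `|(t - s) 0 i| <= (2 ^+ n)^-1) ->
  adjacent (round_index n s) (round_index n t).
Proof.
move=> s01 t01 st i.
have /andP[s1 s2] := round_index_itv n i s01.
have /andP[t1 t2] := round_index_itv n i t01.
have p0 : 0 < 2 ^+ n :> R by rewrite exprn_gt0.
have := st i; rewrite !mxE -(ler_pM2l p0) -{1}(gtr0_norm p0) -normrM.
rewrite mulfV ?gt_eqF// mulrBr ler_norml => /andP[st1 st2].
split; rewrite -ltnS -(ltr_nat R) -!natr1; lra.
Qed.

(** The integer part of 2x is either 2k or 2k + 1, where k is the integer part of x. *)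
Lemma adjacent_refine n t : unit_cube t ->
  adjacent (refine (round_index n t)) (round_index n.+1 t).
Proof.
move=> t01 i.
have /andP[s1 s2] := round_index_itv n i t01.
have /andP[t1 t2] := round_index_itv n.+1 i t01.
rewrite val_refine; rewrite exprS in t1 t2.
split; rewrite -ltnS -(ltr_nat R) -!natr1 -mul2n natrM; lra.
Qed.

Lemma ler_enorm v i : `|v 0 i| <= enorm v.
Proof.
rewrite -sqrtr_sqr ler_sqrt ?sumr_ge0// => [|j _]; last exact: sqr_ge0.
by rewrite (bigD1 i)//= lerDl sumr_ge0// => j _; exact: sqr_ge0.
Qed.

Lemma enorm_ge0 v : 0 <= enorm v. Proof. exact: sqrtr_ge0. Qed.

Lemma enorm_gt0 v : v != 0 -> 0 < enorm v.
Proof.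
move=> v0; have [i vi] : exists i, v 0 i != 0.
  apply/existsP; apply: contraR v0; rewrite negb_exists => /forallP v0.
  by apply/eqP/rowP => i; rewrite mxE; apply/eqP; rewrite -[_ == _]negbK.
by rewrite (lt_le_trans _ (ler_enorm v i))// normr_gt0.
Qed.

Lemma enorm_le v c : (forall i, `|v 0 i| <= c) -> enorm v <= d%:R * c.
Proof.
move=> vc; case: (posnP d) => [d0|d_gt0].
  rewrite /enorm big1 ?sqrtr0 ?d0 ?mul0r// => i.
  by have := ltn_ord i; rewrite {2}d0.
have c0 : 0 <= c by apply: le_trans (vc (Ordinal d_gt0)); exact: normr_ge0.
rewrite -(ger0_norm (mulr_ge0 (ler0n _ d) c0)) -sqrtr_sqr ler_wsqrtr//.
apply: (@le_trans _ _ (\sum_(i < d) c ^+ 2)).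
  by apply: ler_sum => i _; rewrite -real_normK ?num_real// lerXn2r ?nnegrE.
(* The crude factor d in place of its square root comes from d <= d^2. *)
rewrite sumr_const card_ord -[leLHS]mulr_natl exprMn ler_wpM2r ?sqr_ge0//.
by rewrite -natrX ler_nat -{1}(expn1 d) leq_pexp2l.
Qed.

(* The scale at which the pair s, t is chained: 2^-n bounds |t - s| from above
   in the sup norm and from below, up to a factor 2, in the Euclidean norm. *)
Lemma dyadic_scale s t : unit_cube s -> unit_cube t -> s <> t ->
  exists n, (forall i, `|(t - s) 0 i| <= (2 ^+ n)^-1) /\
            (2 ^+ n.+1)^-1 <= enorm (t - s).
Proof.
move=> s01 t01 st.
have ts0 : t - s != 0 by rewrite subr_eq0 eq_sym; apply/eqP.
pose far m := [exists i, (2 ^+ m)^-1 < `|(t - s) 0 i|].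
have exfar : exists m, far m.
  have [i ti] : exists i, (t - s) 0 i != 0.
    apply/existsP; apply: contraR ts0; rewrite negb_exists => /forallP v0.
    by apply/eqP/rowP => i; rewrite [RHS]mxE; apply/eqP; rewrite -[_ == _]negbK.
  have [m mi] : exists m, (2 ^+ m)^-1 < `|(t - s) 0 i|.
    have q1 : `|2^-1 : R| < 1 by rewrite ger0_norm//; lra.
    have := cvg_geometric 1 q1; rewrite -normr_gt0 in ti.
    move=> /cvgr0_norm_lt /(_ _ ti)[m _ /(_ m (leqnn m))/=].
    rewrite /geometric/= mul1r normrX ger0_norm ?invr_ge0// exprVn => ?.
    by exists m.
  by exists m; apply/existsP; exists i.
(* The least such level m is positive, since coordinates in the cube differ by at most 1. With n = m
   - 1, minimality gives the upper bound and m itself the lower one. *)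
case: (ex_minnP exfar) => m farm minm.
case: m farm minm => [/existsP[i]|n /existsP[i fari] minm].
  have := s01 i; have := t01 i; rewrite expr0 invr1 !mxE => /andP[? ?] /andP[? ?].
  by rewrite lter_normr; lra.
exists n; split; last exact: le_trans (ltW fari) (ler_enorm _ _).
move=> j; rewrite leNgt; apply/negP => farj.
have /minm : far n by apply/existsP; exists j.
by rewrite ltnn.
Qed.

End dyadic_grid.

(** * Deterministic chaining along a single path *)

Section chaining.
Context {R : realType} {d : nat}.
Variables (f : 'rV[R]_d -> R) (A r : R).
Hypotheses (A_ge0 : 0 <= A) (r_gt0 : 0 < r) (r_lt1 : r < 1).
Hypothesis f_step : forall n (k : {ffun 'I_d -> 'I_(2 ^ n).+1}) e,
  `|f (grid_point k) - f (grid_point (neighbour k e))| <= A * r ^+ n.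
Implicit Types (n m : nat) (s t : 'rV[R]_d).

Let f_adjacent n (k l : {ffun 'I_d -> 'I_(2 ^ n).+1}) : adjacent k l ->
  `|f (grid_point k) - f (grid_point l)| <= A * r ^+ n.
Proof. by move=> /adjacent_neighbour[e <-]; exact: f_step. Qed.

Let f_round_succ n t : unit_cube t ->
  `|f (dyadic_round n t) - f (dyadic_round n.+1 t)| <= A * r ^+ n.
Proof.
(* The level-n point is also a grid point of level n + 1, so a single step of that level suffices;
   its bound A r^(n+1) is weakened to A r^n. *)
move=> t01; rewrite /dyadic_round -grid_point_refine.
apply: le_trans (f_adjacent (adjacent_refine n t01)) _.
by rewrite exprS mulrCA ler_piMl ?(ltW r_lt1) ?mulr_ge0 ?exprn_ge0 ?(ltW r_gt0).
Qed.

Lemma dyadic_chain n m t : unit_cube t -> (n <= m)%N ->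
  `|f (dyadic_round n t) - f (dyadic_round m t)| <= A * r ^+ n / (1 - r).
Proof.
move=> t01 nm; have r1 : 0 < 1 - r by rewrite subr_gt0.
(* The induction on m needs the exact partial sum of the geometric series; the stated bound alone is
   not inductive. *)
apply: (@le_trans _ _ (A * (r ^+ n - r ^+ m) / (1 - r))); last first.
  rewrite ler_pM2r ?invr_gt0// ler_wpM2l// gerBl exprn_ge0// ltW//.
elim: m nm => [|m IH].
  by rewrite leqn0 => /eqP ->; rewrite !subrr normr0 mulr0 mul0r.
rewrite leq_eqVlt => /orP[/eqP ->|]; first by rewrite !subrr normr0 mulr0 mul0r.
rewrite ltnS => /IH {}IH.
rewrite (le_trans (ler_distD (f (dyadic_round m t)) _ _))//.
apply: le_trans (lerD IH (f_round_succ m t01)) _.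
rewrite le_eqVlt; apply/orP; left; apply/eqP; rewrite exprS; field.
by rewrite gt_eqF.
Qed.

Lemma dyadic_round_is_cvg t : unit_cube t ->
  cvgn (fun n => f (dyadic_round n t)).
Proof.
move=> t01; apply/cauchy_cvgP; apply: cauchy_exP => e e0 /=.
have q1 : `|r| < 1 by rewrite gtr0_norm.
have [n _ /(_ n (leqnn n))/=] := cvgr0_norm_lt _ (cvg_geometric (A / (1 - r)) q1) _ e0.
rewrite /geometric/= => /(le_lt_trans (ler_norm _)) small.
exists (f (dyadic_round n t)); exists n => // m /= nm.
rewrite -ball_normE /ball_/=; apply: le_lt_trans (dyadic_chain t01 nm) _.
by rewrite mulrAC.
Qed.

(** Go from s_m to s_n, across to t_n, and on to t_m: one step at level n and two tails A r^n / (1 -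
    r), uniformly in m >= n. *)
Lemma dyadic_limit_dist n s t : unit_cube s -> unit_cube t ->
  (forall i, `|(t - s) 0 i| <= (2 ^+ n)^-1) ->
  `|limn (fun m => f (dyadic_round m t)) - limn (fun m => f (dyadic_round m s))|
    <= (1 + 2 / (1 - r)) * A * r ^+ n.
Proof.
move=> s01 t01 st.
have cs := dyadic_round_is_cvg s01; have ct := dyadic_round_is_cvg t01.
rewrite -limB// -lim_norm; last exact: is_cvgB.
apply: limr_le; first by apply: is_cvg_norm; exact: is_cvgB.
exists n => // m nm.
rewrite [leLHS](_ : _ = `|f (dyadic_round m t) - f (dyadic_round m s)|)//.
have := dyadic_chain t01 nm; have := dyadic_chain s01 nm.
have := f_adjacent (adjacent_round s01 t01 st).
rewrite -!/(dyadic_round _ _) !ler_norml => /andP[? ?] /andP[? ?] /andP[? ?].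
have -> : (1 + 2 / (1 - r)) * A * r ^+ n =
  A * r ^+ n + 2 * (A * r ^+ n / (1 - r)) by ring.
apply/andP; split; lra.
Qed.

End chaining.

Lemma powR_half_lt1 (R : realType) (b : R) : 0 < b -> 2^-1 `^ b < 1.
Proof.
move=> b0; rewrite -[ltRHS](_ : 1 `^ b = 1); last by rewrite powR1.
by rewrite gt0_ltr_powR ?nnegrE//; lra.
Qed.

(** With r = 2^-b, the scale n of [dyadic_scale] satisfies r^(n+1) <= |t - s|^b. The division by r
    in the constant pays for the shift from n to n + 1. *)
Lemma chaining_holder (R : realType) (d : nat) (f : 'rV[R]_d -> R) (A b : R) :
  0 <= A -> 0 < b ->
  (forall n (k : {ffun 'I_d -> 'I_(2 ^ n).+1}) e,
    `|f (grid_point k) - f (grid_point (neighbour k e))|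
      <= A * (2^-1 `^ b) ^+ n) ->
  forall s t, unit_cube s -> unit_cube t ->
  `|limn (fun m => f (dyadic_round m t)) - limn (fun m => f (dyadic_round m s))|
    <= (1 + 2 / (1 - 2^-1 `^ b)) / 2^-1 `^ b * A * enorm (t - s) `^ b.
Proof.
move=> A0 b0 f_step s t s01 t01; set r := 2^-1 `^ b.
have r0 : 0 < r by rewrite powR_gt0.
have r1 : r < 1 by exact: powR_half_lt1.
have c0 : 0 <= (1 + 2 / (1 - r)) by rewrite addr_ge0// divr_ge0//; lra.
have [<-|/eqP st] := eqVneq s t.
  by rewrite !subrr normr0 !mulr_ge0// ?powR_ge0// invr_ge0 ltW.
have [n [stn nst]] := dyadic_scale s01 t01 st.
apply: le_trans (dyadic_limit_dist A0 r0 r1 f_step s01 t01 stn) _.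
have -> : (1 + 2 / (1 - r)) * A * r ^+ n = (1 + 2 / (1 - r)) / r * A * r ^+ n.+1.
  by rewrite exprS; field; rewrite !gt_eqF//; lra.
rewrite ler_wpM2l//; first by rewrite !mulr_ge0// invr_ge0 ltW.
rewrite /r -powR_mulrn ?powR_ge0// -powRrM mulrC powRrM powR_mulrn ?invr_ge0//.
by rewrite exprVn ge0_ler_powR ?nnegrE ?enorm_ge0 ?invr_ge0 ?exprn_ge0// ltW.
Qed.

(** * Polar sets and upper expectations *)

Section quasi_sure.
Context {R : realType} {Omega : completeMetricType R}.
Variable PP : set (probability (borel Omega) R).
Hypothesis PP_neq0 : PP !=set0.
Local Open Scope ereal_scope.
Implicit Types (P : probability (borel Omega) R) (A N : set (borel Omega)).

Lemma measurable_continuous (f : Omega -> R) :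
  continuous f -> measurable_fun [set: borel Omega] f.
Proof.
move=> /continuousP cf.
apply: (measurability _ (RGenOpens.measurableE R)) => _ [_ [x [y ->]] <-].
by rewrite setTI; apply: sub_sigma_algebra; apply: cf; exact: interval_open.
Qed.

(** Moment bounds are proved through this equivalence under one fixed P at a time, where integration
    is linear and monotone convergence is available. *)
Lemma upper_expectation_leP (X : borel Omega -> \bar R) c :
  upper_expectation PP X <= c <-> forall P, PP P -> \int[P]_w X w <= c.
Proof.
split=> [Xc P PPP|Xc].
  by apply: le_trans Xc; apply: ereal_sup_ubound; exists P.
by apply: ge_ereal_sup => _ [P PPP <-]; exact: Xc.
Qed.

Lemma polarP A : polar PP A <-> measurable A /\ forall P, PP P -> P A = 0.
Proof.
split=> [[mA A0]|[mA A0]]; split=> //.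
  move=> P PPP; apply/eqP; rewrite eq_le measure_ge0 andbT -A0.
  by apply: ereal_sup_ubound; exists P.
(* Nonemptiness of [PP] matters here: an empty supremum would be -oo. *)
rewrite /capacity (_ : [set P A | P in PP] = [set 0]) ?ereal_sup1//.
apply/seteqP; split=> [_ [P PPP <-]|_ ->]; first exact: A0.
by have [P PPP] := PP_neq0; exists P => //; exact: A0.
Qed.

Lemma polar_bigcup (N : nat -> set (borel Omega)) :
  (forall k, polar PP (N k)) -> polar PP (\bigcup_k N k).
Proof.
move=> /(_ _)/polarP N0; apply/polarP.
have mN : measurable (\bigcup_k N k).
  by apply: bigcupT_measurable => k; case: (N0 k).
split=> // P PPP; apply/negligibleP => //; apply: negligible_bigcup => k.
by have [mNk Nk0] := N0 k; apply/negligibleP => //; exact: Nk0.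
Qed.

Lemma polarU A N : polar PP A -> polar PP N -> polar PP (A `|` N).
Proof.
move=> /polarP[mA A0] /polarP[mN N0]; apply/polarP.
split; first exact: measurableU.
move=> P PPP; apply/negligibleP; first exact: measurableU.
by apply: negligibleU; apply/negligibleP => //; [exact: A0|exact: N0].
Qed.

Lemma qs_upper_expectation (X Y : borel Omega -> \bar R) :
  measurable_fun [set: borel Omega] X -> measurable_fun [set: borel Omega] Y ->
  (forall w, 0 <= X w) -> (forall w, 0 <= Y w) -> qs PP (fun w => X w = Y w) ->
  upper_expectation PP X = upper_expectation PP Y.
Proof.
move=> mX mY X0 Y0 [N /polarP[mN N0] XY].
congr ereal_sup; apply: eq_imagel => P PPP.
apply: ge0_ae_eq_integral => //.
exists N; split; [by []|exact: N0|move=> w /= XYw].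
by apply: contrapT => Nw; apply: XYw => _; exact: XY.
Qed.

(** * Series of nonnegative variables with geometrically decaying moments *)

Section geometric_moments.
Variables (F : nat -> borel Omega -> R) (K q : R).
Hypotheses (mF : forall n, measurable_fun [set: borel Omega] (F n))
  (F_ge0 : forall n w, (0 <= F n w)%R)
  (K_ge0 : (0 <= K)%R) (q_gt0 : (0 < q)%R) (q_lt1 : (q < 1)%R).
Hypothesis F_moment : forall n,
  upper_expectation PP (fun w => (F n w)%:E) <= (K * q ^+ n)%:E.

Let G w := \sum_(0 <= n <oo) (F n w)%:E.

Lemma measurable_geometric_series : measurable_fun [set: borel Omega] G.
Proof.
apply: ge0_emeasurable_sum => [n w _ _|n _]; first by rewrite lee_fin.
exact/measurable_EFinP.
Qed.

Lemma upper_expectation_series : upper_expectation PP G <= (K / (1 - q))%:E.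
Proof.
apply/upper_expectation_leP => P PPP; rewrite integral_nneseries//; last 2 first.
- by move=> n; exact/measurable_EFinP.
- by move=> n w _; rewrite lee_fin.
apply: (@le_trans _ _ (\sum_(0 <= n <oo) (K * q ^+ n)%:E)).
  apply: lee_nneseries => [n _ _|n _].
    by apply: integral_ge0 => w _; rewrite lee_fin.
  by have /upper_expectation_leP := F_moment n; exact.
apply: lime_le.
  by apply: is_cvg_nneseries => n _ _; rewrite lee_fin mulr_ge0// exprn_ge0// ltW.
apply: nearW => n; rewrite sumEFin lee_fin.
by apply: geometric_le_lim; rewrite ?gtr0_norm.
Qed.

(** A series with finite upper expectation is finite almost surely under every P. This stands in for
    a Borel-Cantelli argument, both for the chaining bound and for the convergence of X_(t_n) to
    X_t. *)
Lemma polar_geometric_series : polar PP [set w | G w = +oo].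
Proof.
have mG := measurable_geometric_series.
have mA : measurable [set w : borel Omega | G w = +oo].
  by rewrite -[X in measurable X]setTI; exact: mG _ (emeasurable_set1 _).
apply/polarP; split=> // P PPP.
have G0 w : 0 <= G w by apply: nneseries_ge0 => n _ _; rewrite lee_fin.
have iG : P.-integrable setT G.
  apply/integrableP; split=> //; under eq_integral do rewrite gee0_abs//.
  have /upper_expectation_leP/(_ _ PPP) := upper_expectation_series.
  by move=> /le_lt_trans; apply; rewrite ltry.
apply/negligibleP => //.
have [N [mN N0 GN]] := integrable_ae measurableT iG.
exists N; split=> // w /= Gw; apply: GN => /= /(_ I).
by rewrite Gw.
Qed.

End geometric_moments.
End quasi_sure.

(** * Hölder quotients: change of exponent, and measurability of their supremum *)

Section holder_quotient.
Context {R : realType} {d : nat}.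
Implicit Types (f : 'rV[R]_d -> R) (s t v : 'rV[R]_d) (a b K : R).

(** The cube has Euclidean diameter at most d, so |t - s|^(b - a) <= d^(b - a). The exponent [a] may
    be zero or negative. *)
Lemma holder_le_exponent K a b (s t : 'rV[R]_d) (y : R) :
  0 <= K -> a <= b -> 0 < b -> unit_cube s -> unit_cube t ->
  y <= K * enorm (t - s) `^ b ->
  y <= K * d%:R `^ (b - a) * enorm (t - s) `^ a.
Proof.
move=> K0 ab b0 s01 t01 yK; apply: le_trans yK _.
rewrite -mulrA ler_wpM2l//.
(* Splitting the power as (b - a) + a requires a nonzero base; at base 0 the left side vanishes
   because b > 0. *)
have [->|v0] := eqVneq (enorm (t - s)) 0.
  by rewrite powR0 ?gt_eqF// mulr_ge0// powR_ge0.
have {1}-> : b = (b - a) + a by rewrite subrK.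
rewrite powRD; last by rewrite v0 implybT.
rewrite ler_wpM2r ?powR_ge0// ge0_ler_powR ?subr_ge0 ?nnegrE ?enorm_ge0//.
rewrite -[d%:R]mulr1; apply: enorm_le => i.
have /andP[? ?] := s01 i; have /andP[? ?] := t01 i.
by rewrite !mxE ler_norml; lra.
Qed.

Lemma holder_quotient_sup_le f a K :
  (forall s t, unit_cube s -> unit_cube t ->
    `|f t - f s| <= K * enorm (t - s) `^ a) ->
  (holder_quotient_sup a f <= K%:E)%E.
Proof.
move=> fK; apply: ge_ereal_sup => _ [s [t [s01 t01 st ->]]].
have ts0 : t - s != 0 by rewrite subr_eq0 eq_sym; apply/eqP.
by rewrite lee_fin ler_pdivrMr ?powR_gt0 ?enorm_gt0//; exact: fK.
Qed.

(** Two distinct points of the cube must exist: in dimension 0 the supremum is empty, hence -oo. *)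
Lemma holder_quotient_sup_ge0 f a : (0 < d)%N -> (0 <= holder_quotient_sup a f)%E.
Proof.
move=> d0; pose q : R := `|f (const_mx 1) - f 0| / enorm (const_mx 1 - 0 : 'rV_d) `^ a.
apply: (@le_trans _ _ q%:E).
  by rewrite lee_fin divr_ge0// powR_ge0.
apply: ereal_sup_ubound; exists 0, (const_mx 1); split=> //.
- by move=> i; rewrite mxE lexx ler01.
- by move=> i; rewrite mxE lexx ler01.
- by move=> /rowP/(_ (Ordinal d0))/eqP; rewrite !mxE eq_sym oner_eq0.
Qed.

Lemma cvg_inv_expr2 : (2 ^+ n)^-1 @[n --> \oo] --> (0 : R).
Proof.
have q1 : `|2^-1 : R| < 1 by rewrite ger0_norm//; lra.
apply: cvg_trans (cvg_geometric 1 q1); apply: near_eq_cvg.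
by apply: nearW => n; rewrite /geometric/= mul1r exprVn.
Qed.

Lemma dyadic_round_cvg t i : unit_cube t ->
  (dyadic_round n t) 0 i @[n --> \oo] --> t 0 i.
Proof.
move=> t01; apply/cvgrPdist_le => e e0.
have := cvgr0_norm_le _ cvg_inv_expr2 _ e0.
move=> [m _ mP]; exists m => // n /= /mP/=.
rewrite ger0_norm ?invr_ge0 ?exprn_ge0//; apply: le_trans.
by have := dyadic_round_dist n i t01; rewrite !mxE distrC.
Qed.

Lemma enorm_dyadic_cvg s t : unit_cube s -> unit_cube t ->
  enorm (dyadic_round n t - dyadic_round n s) @[n --> \oo] --> enorm (t - s).
Proof.
move=> s01 t01.
apply: (continuous_cvg _ (@sqrt_continuous R _)).
apply: cvg_big => [|i _]; first exact: add_continuous.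
have mxB (u v : 'rV[R]_d) : (u - v) 0 i = u 0 i - v 0 i by rewrite !mxE.
under eq_cvg do rewrite mxB expr2.
rewrite mxB expr2.
by apply: cvgM; apply: cvgB; exact: dyadic_round_cvg.
Qed.

Lemma continuous_powR_gt0 a (x : R) : 0 < x -> {for x, continuous (@powR R ^~ a)}.
Proof.
move=> x0; apply/differentiable_continuous/derivable1_diffP.
by apply: derivable_powR; rewrite in_itv/= x0.
Qed.

Lemma holder_dyadic_cvg f b K t : 0 <= K -> 0 < b ->
  (forall s t, unit_cube s -> unit_cube t ->
    `|f t - f s| <= K * enorm (t - s) `^ b) ->
  unit_cube t -> f (dyadic_round n t) @[n --> \oo] --> f t.
Proof.
move=> K0 b0 fK t01.
pose r : R := 2^-1 `^ b.
have r0 : 0 < r by rewrite powR_gt0.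
have q1 : `|r| < 1.
  by rewrite gtr0_norm//; exact: powR_half_lt1.
apply/cvgrPdist_le => e e0.
have := cvgr0_norm_le _ (cvg_geometric (K * d%:R `^ b) q1) _ e0.
move=> [m _ mP]; exists m => // n /= /mP/=; apply: le_trans.
apply: le_trans (fK _ _ (grid_point_cube _) t01) _.
rewrite /geometric/= ger0_norm; last by rewrite !mulr_ge0 ?powR_ge0 ?exprn_ge0 ?(ltW r0).
rewrite -mulrA ler_wpM2l// /r -powR_mulrn ?powR_ge0// -powRrM (mulrC b) powRrM.
rewrite powR_mulrn ?invr_ge0// -powRM ?exprn_ge0 ?invr_ge0//.
rewrite ge0_ler_powR ?nnegrE ?enorm_ge0 ?mulr_ge0 ?exprn_ge0 ?invr_ge0 ?(ltW b0)//.
rewrite exprVn; apply: enorm_le => i.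
by rewrite -opprB mxE normrN; exact: dyadic_round_dist.
Qed.

(** The quotients at the rounded points converge to the quotient at s, t, so a strict lower bound
    already holds at some finite level. This replaces an uncountable family of pairs by the
    countable family of grid pairs. *)
Lemma holder_quotient_sup_dyadic f a (c : \bar R) :
  (forall t, unit_cube t -> f (dyadic_round n t) @[n --> \oo] --> f t) ->
  (c < holder_quotient_sup a f)%E ->
  exists n (k l : {ffun 'I_d -> 'I_(2 ^ n).+1}),
    @grid_point R d n k != grid_point l /\
    (c < (`|f (grid_point l) - f (grid_point k)|
           / enorm (grid_point l - grid_point k) `^ a)%:E)%E.
Proof.
move=> fcvg /ereal_sup_gtP[_ [s [t [s01 t01 st ->]]]].
have ts0 : 0 < enorm (t - s).
  by rewrite enorm_gt0// subr_eq0 eq_sym; apply/eqP.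
set q := _ / _ => cq.
have qcvg : `|f (dyadic_round n t) - f (dyadic_round n s)|
    / enorm (dyadic_round n t - dyadic_round n s) `^ a @[n --> \oo] --> q.
  apply: cvgM.
    by apply: cvg_norm; apply: cvgB; exact: fcvg.
  apply: cvgV; first by rewrite gt_eqF// powR_gt0.
  have powc := continuous_powR_gt0 (a := a) ts0.
  exact: (continuous_cvg _ powc (enorm_dyadic_cvg s01 t01)).
have [n [cn0 cnq]] : exists n,
    0 < enorm (dyadic_round n t - dyadic_round n s) /\
    (c < (`|f (dyadic_round n t) - f (dyadic_round n s)|
    / enorm (dyadic_round n t - dyadic_round n s) `^ a)%:E)%E.
  have near0 := cvgr_gt _ (enorm_dyadic_cvg s01 t01) _ ts0.
  (* The value +oo is impossible for c; for c = -oo only the distinctness of the rounded points has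
     to be secured. *)
  move: c cq => [c|//|_].
  - rewrite lte_fin => cq; have nearc := cvgr_gt _ qcvg _ cq.
    have [n _ nP] := filterI (near0 _) (nearc _).
    by exists n; have [? ?] := nP n (leqnn n); rewrite lte_fin.
  - by have [n _ nP] := near0 _; exists n; rewrite ltNyr; split=> //;
    exact: nP n (leqnn n).
exists n, (round_index n s), (round_index n t); split=> //.
apply: contraTneq cn0 => kl; rewrite /dyadic_round kl subrr.
by rewrite /enorm big1 ?sqrtr0 ?ltxx// => i _; rewrite mxE expr0n.
Qed.

(** By [holder_quotient_sup_dyadic], the set where the supremum exceeds c is a countable union, over
    pairs of distinct grid points, of measurable sets. *)
Lemma measurable_holder_quotient_sup d' (T : measurableType d')
    (Y : 'rV[R]_d -> T -> R) a :
  (forall t, unit_cube t -> measurable_fun [set: T] (Y t)) ->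
  (forall w t, unit_cube t ->
    Y (dyadic_round n t) w @[n --> \oo] --> Y t w) ->
  measurable_fun [set: T] (fun w => holder_quotient_sup a (Y ^~ w)).
Proof.
move=> mY Ycvg.
apply: (measurability _ (ErealGenOInfty.measurableE R)) => _ [_ [c ->]] <-.
pose q n (k l : {ffun 'I_d -> 'I_(2 ^ n).+1}) w :=
  `|Y (grid_point l) w - Y (grid_point k) w|
  / enorm (grid_point l - grid_point k : 'rV[R]_d) `^ a.
rewrite [X in measurable X](_ : _ = \bigcup_n \bigcup_k \bigcup_l
  [set w | @grid_point R d n k != grid_point l /\ (c%:E < (q n k l w)%:E)%E]); last first.
  apply/seteqP; split=> w /=.
    rewrite in_itv/= andbT => -[_ /(holder_quotient_sup_dyadic (Ycvg w))].
    by move=> [n [k [l kl]]]; exists n => //; exists k => //; exists l.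
  move=> [n _ [k _ [l _ [kl cq]]]]; split=> //.
  rewrite in_itv/= andbT; apply/ereal_sup_gtP; exists (q n k l w)%:E => //.
  exists (grid_point k), (grid_point l).
  by split=> //; [exact: grid_point_cube|exact: grid_point_cube|exact/eqP].
apply: bigcupT_measurable => n.
apply: countable_bigcupT_measurable => [|k]; first exact: countableP.
apply: countable_bigcupT_measurable => [|l]; first exact: countableP.
have [kl|kl] := eqVneq (@grid_point R d n k) (grid_point l).
  by rewrite [X in measurable X](_ : _ = set0)//; apply/seteqP; split=> // w [].
have mq : measurable_fun [set: T] (EFin \o q n k l).
  apply/measurable_EFinP; apply: measurable_funM; last exact: measurable_cst.
  apply: measurableT_comp => //.
  by apply: measurable_funB; apply: mY; exact: grid_point_cube.
rewrite [X in measurable X](_ : _ =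
    [set: T] `&` [set w | (c%:E < (EFin \o q n k l) w)%E]).
  exact: emeasurable_fun_o_infty.
by apply/seteqP; split=> w /= [].
Qed.

End holder_quotient.

(** * Moments of the increments between neighbouring grid points *)

Section neighbour_moments.
Context {R : realType} {Omega : completeMetricType R} {d : nat}.
Variable PP : set (probability (borel Omega) R).
Variables (X : 'rV[R]_d -> borel Omega -> R) (p C eps : R).
Hypotheses (p_gt0 : 0 < p) (C_gt0 : 0 < C) (eps_gt0 : 0 < eps).
Hypothesis mX : forall t, unit_cube t -> measurable_fun [set: borel Omega] (X t).
Hypothesis X_moment : forall s t, unit_cube s -> unit_cube t ->
  (upper_expectation PP (fun w => (`|X t w - X s w| `^ p)%R%:E)
     <= (C * enorm (t - s) `^ (d%:R + eps))%R%:E)%E.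
Implicit Types (s t : 'rV[R]_d) (b : R) (n : nat) (w : borel Omega).

Definition increment_moment s t w : R := `|X t w - X s w| `^ p.

(** A sum dominates the maximum over neighbouring pairs and can be integrated term by term. Trivial
    moves and the repetitions caused by clipping are harmless. *)
Definition neighbour_moment n w : R :=
  \sum_(k : {ffun 'I_d -> 'I_(2 ^ n).+1}) \sum_(e : {ffun 'I_d -> 'I_3})
    increment_moment (grid_point (neighbour k e)) (grid_point k) w.

(* The factor is 2^(nbp). *)
Definition scaled_moment b n w : R :=
  neighbour_moment n w / ((2^-1 `^ b) `^ p) ^+ n.

Definition total_moment b w : \bar R :=
  (\sum_(0 <= n <oo) (scaled_moment b n w)%:E)%E.

Lemma increment_moment_ge0 s t w : 0 <= increment_moment s t w.
Proof. exact: powR_ge0. Qed.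

Lemma measurable_increment_moment s t : unit_cube s -> unit_cube t ->
  measurable_fun [set: borel Omega] (increment_moment s t).
Proof.
move=> s01 t01; apply: (measurableT_comp (measurable_powR p)).
by apply: measurableT_comp => //; apply: measurable_funB; exact: mX.
Qed.

Lemma measurable_neighbour_moment n :
  measurable_fun [set: borel Omega] (neighbour_moment n).
Proof.
apply: measurable_sum => k; apply: measurable_sum => e.
by apply: measurable_increment_moment; exact: grid_point_cube.
Qed.

Lemma neighbour_moment_ge0 n w : 0 <= neighbour_moment n w.
Proof.
by do 2! [apply: sumr_ge0 => ? _]; exact: increment_moment_ge0.
Qed.

Lemma increment_expectation_le s t c : unit_cube s -> unit_cube t ->
  (forall i, `|(t - s) 0 i| <= c) ->
  (upper_expectation PP (fun w => (increment_moment s t w)%:E)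
    <= (C * (d%:R * c) `^ (d%:R + eps))%:E)%E.
Proof.
move=> s01 t01 tsc; apply: le_trans (X_moment s01 t01) _.
have le_dc := enorm_le tsc.
rewrite lee_fin ler_wpM2l ?(ltW C_gt0)//.
rewrite ge0_ler_powR ?nnegrE ?enorm_ge0 ?addr_ge0 ?(ltW eps_gt0)//.
exact: le_trans (enorm_ge0 _) le_dc.
Qed.

(* 6 = 2 * 3: there are (2^n + 1)^d <= (2 * 2^n)^d grid points, each with 3^d
   neighbours. *)
Let Kd : R := 6 ^+ d * (C * d%:R `^ (d%:R + eps)).

(** Each term is of order 2^(-n(d + eps)); the part 2^(-nd) cancels the number of grid points and
    leaves 2^(-n eps). *)
Lemma neighbour_expectation_le n :
  (upper_expectation PP (fun w => (neighbour_moment n w)%:E)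
    <= (Kd * (2^-1 `^ eps) ^+ n)%:E)%E.
Proof.
set c : R := C * (d%:R * (2 ^+ n)^-1) `^ (d%:R + eps).
apply/upper_expectation_leP => P PPP.
under eq_integral do rewrite -sumEFin.
have mI k e : measurable_fun [set: borel Omega]
    (fun w => (increment_moment (grid_point (@neighbour d n k e)) (grid_point k) w)%:E).
  apply/measurable_EFinP.
  by apply: measurable_increment_moment; exact: grid_point_cube.
rewrite ge0_integral_sum//; last 2 first.
- move=> k; under eq_fun do rewrite -sumEFin.
  exact: emeasurable_sum.
- by move=> k w _; rewrite lee_fin sumr_ge0// => ? _; exact: increment_moment_ge0.
apply: (@le_trans _ _ (\sum_(k : {ffun 'I_d -> 'I_(2 ^ n).+1})
    \sum_(e : {ffun 'I_d -> 'I_3}) c%:E)%E).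
  apply: lee_sum => k _; under eq_integral do rewrite -sumEFin.
  rewrite ge0_integral_sum//; last first.
    by move=> e w _; rewrite lee_fin increment_moment_ge0.
  apply: lee_sum => e _; move: P PPP; apply/upper_expectation_leP.
  apply: increment_expectation_le; [exact: grid_point_cube..|move=> i].
  by rewrite -opprB mxE normrN; exact: neighbour_dist.
under eq_bigr do rewrite sumEFin.
have c0 : 0 <= c by rewrite mulr_ge0 ?powR_ge0// ltW.
have p0 : 0 < 2 ^+ n :> R by rewrite exprn_gt0.
rewrite sumEFin lee_fin !sumr_const !card_ffun !card_ord -mulrnA -[leLHS]mulr_natl.
apply: (@le_trans _ _ ((6 * 2 ^+ n) ^+ d * c)).
  rewrite ler_wpM2r// -expnMn natrX lerXn2r ?nnegrE ?mulr_ge0 ?exprn_ge0//.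
  rewrite natrM -[X in _ * X]natr1 natrX.
  have : 1 <= 2 ^+ n :> R by rewrite exprn_ege1// ler1n.
  lra.
rewrite /c /Kd exprMn -!mulrA ler_wpM2l ?exprn_ge0//.
rewrite powRM ?invr_ge0 ?exprn_ge0// [in leLHS]mulrCA ler_wpM2l ?(ltW C_gt0)//.
rewrite [in leLHS]mulrCA ler_wpM2l ?powR_ge0//.
rewrite powRD; last by rewrite invr_eq0 (gt_eqF p0) implybT.
rewrite powR_mulrn ?invr_ge0 ?exprn_ge0// mulrA -exprMn mulfV ?gt_eqF// expr1n mul1r.
rewrite -[X in _ <= X]powR_mulrn ?powR_ge0// -powRrM (mulrC eps) powRrM.
by rewrite powR_mulrn ?invr_ge0// exprVn.
Qed.

(** The weight 2^(nbp) against the decay 2^(-n eps) leaves the ratio 2^-(eps - bp), which is below 1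
    when b < eps / p. *)
Lemma scaled_expectation_le b n :
  (upper_expectation PP (fun w => (scaled_moment b n w)%:E)
    <= (Kd * (2^-1 `^ (eps - b * p)) ^+ n)%:E)%E.
Proof.
apply/upper_expectation_leP => P PPP; rewrite /scaled_moment.
have q0 : 0 < ((2^-1 `^ b) `^ p) ^+ n :> R by rewrite exprn_gt0// !powR_gt0.
under eq_integral do rewrite EFinM muleC.
rewrite ge0_integralZl//; last 2 first.
- by apply/measurable_EFinP; exact: measurable_neighbour_moment.
- by move=> w _; rewrite lee_fin neighbour_moment_ge0.
have /upper_expectation_leP/(_ P PPP) Sn := neighbour_expectation_le n.
apply: (le_trans (lee_wpmul2l _ Sn)); first by rewrite lee_fin invr_ge0 ltW.
rewrite -EFinM lee_fin mulrC ler_pdivrMr// -[leRHS]mulrA -exprMn -powRrM -powRD.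
  by rewrite subrK.
by rewrite invr_eq0 pnatr_eq0 implybT.
Qed.

Lemma scaled_moment_ge0 b n w : 0 <= scaled_moment b n w.
Proof.
by rewrite divr_ge0 ?neighbour_moment_ge0// exprn_ge0// powR_ge0.
Qed.

Lemma measurable_scaled_moment b n :
  measurable_fun [set: borel Omega] (scaled_moment b n).
Proof.
apply: measurable_funM; last exact: measurable_cst.
exact: measurable_neighbour_moment.
Qed.

Lemma total_moment_ge0 b w : (0 <= total_moment b w)%E.
Proof. by apply: nneseries_ge0 => n _ _; rewrite lee_fin scaled_moment_ge0. Qed.

Lemma measurable_total_moment b :
  measurable_fun [set: borel Omega] (total_moment b).
Proof.
apply: measurable_geometric_series => [n|n w].
  exact: measurable_scaled_moment.
exact: scaled_moment_ge0.
Qed.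

Let Kd_ge0 : 0 <= Kd.
Proof. by rewrite !mulr_ge0 ?exprn_ge0 ?powR_ge0 ?(ltW C_gt0). Qed.

Let ratio_gt0 b : 0 < 2^-1 `^ (eps - b * p) :> R.
Proof. by rewrite powR_gt0// invr_gt0. Qed.

Let ratio_lt1 b : b < eps / p -> 2^-1 `^ (eps - b * p) < 1 :> R.
Proof.
by rewrite ltr_pdivlMr// -subr_gt0; exact: powR_half_lt1.
Qed.

Lemma total_moment_expectation b : b < eps / p ->
  (upper_expectation PP (total_moment b) < +oo)%E.
Proof.
move=> bp; apply: le_lt_trans (ltry _).
apply: (upper_expectation_series _ _ _ _ _ (scaled_expectation_le b)) => //.
- exact: measurable_scaled_moment.
- exact: scaled_moment_ge0.
- exact: ratio_lt1.
Qed.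

Lemma polar_total_moment b : PP !=set0 -> b < eps / p ->
  polar PP [set w | total_moment b w = +oo%E].
Proof.
move=> PP0 bp.
apply: (polar_geometric_series PP0 _ _ _ _ _ (scaled_expectation_le b)) => //.
- exact: measurable_scaled_moment.
- exact: scaled_moment_ge0.
- exact: ratio_lt1.
Qed.

(** A single term is at most the sum S_n, which is at most 2^(-nbp) G_b; then take p-th roots.
    Infinite values must be excluded because [fine] sends them to 0. *)
Lemma neighbour_increment_le b w : total_moment b w <> +oo%E ->
  forall n (k : {ffun 'I_d -> 'I_(2 ^ n).+1}) e,
  `|X (grid_point k) w - X (grid_point (neighbour k e)) w|
    <= (fine (total_moment b w)) `^ p^-1 * (2^-1 `^ b) ^+ n.
Proof.
move=> Gw n k e; set x := `|_|; set r : R := 2^-1 `^ b.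
have r0 : 0 < r by rewrite powR_gt0.
have G0 := total_moment_ge0 b w.
have Gfin : total_moment b w \is a fin_num.
  by rewrite ge0_fin_numE// ltey; apply/eqP.
have xS : x `^ p <= neighbour_moment n w.
  rewrite /neighbour_moment (bigD1 k)//= (bigD1 e)//= -addrA lerDl.
  rewrite addr_ge0// sumr_ge0// => ? _; first exact: increment_moment_ge0.
  by rewrite sumr_ge0// => ? _; exact: increment_moment_ge0.
have SG : scaled_moment b n w <= fine (total_moment b w).
  rewrite -lee_fin fineK//.
  (* The partial sum with bound [n.+1] is the first to contain the term of index [n]. *)
  apply: le_trans (nneseries_lim_ge n.+1 _); last first.
    by move=> m _ _; rewrite lee_fin scaled_moment_ge0.
  rewrite big_nat_recr//= leeDr// sume_ge0// => m _.
  by rewrite lee_fin scaled_moment_ge0.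
have rn0 : 0 < (r `^ p) ^+ n by rewrite exprn_gt0// powR_gt0.
have {}SG : x `^ p <= fine (total_moment b w) * (r `^ p) ^+ n.
  by rewrite -ler_pdivrMr// (le_trans _ SG)// ler_pM2r ?invr_gt0.
have x0 : 0 <= x by exact: normr_ge0.
have -> : x = (x `^ p) `^ p^-1 by rewrite -powRrM mulfV ?gt_eqF// powRr1.
have -> : r ^+ n = ((r `^ p) ^+ n) `^ p^-1.
  rewrite -(@powR_mulrn _ (r `^ p)) ?powR_ge0// -(powRrM r) -(powRrM r).
  by rewrite mulrAC mulfV ?gt_eqF// mul1r powR_mulrn// ltW.
rewrite -powRM ?fine_ge0 ?(ltW rn0)//.
rewrite ge0_ler_powR ?nnegrE ?invr_ge0 ?(ltW p_gt0) ?powR_ge0//.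
by rewrite mulr_ge0 ?fine_ge0 ?(ltW rn0).
Qed.

Lemma dyadic_round_increment t n : unit_cube t ->
  (upper_expectation PP
     (fun w => (increment_moment (dyadic_round n t) t w)%:E)
    <= (C * d%:R `^ (d%:R + eps) * (2^-1 `^ (d%:R + eps)) ^+ n)%:E)%E.
Proof.
move=> t01; apply: (@le_trans _ _ (C * (d%:R * (2 ^+ n)^-1) `^ (d%:R + eps))%:E).
  apply: increment_expectation_le => //; first exact: grid_point_cube.
  by move=> i; rewrite -opprB mxE normrN; exact: dyadic_round_dist.
rewrite lee_fin powRM ?invr_ge0 ?exprn_ge0// mulrA ler_wpM2l//.
  by rewrite mulr_ge0 ?powR_ge0 ?(ltW C_gt0).
rewrite -[X in _ <= X]powR_mulrn ?powR_ge0// -powRrM (mulrC (_ + _)) powRrM.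
by rewrite powR_mulrn ?invr_ge0// exprVn.
Qed.

(** The p-th powers of the errors are summable outside a polar set, so they tend to 0. That set
    depends on t, which the notion of modification allows. *)
Lemma qs_dyadic_round_cvg t : PP !=set0 -> unit_cube t ->
  qs PP (fun w => X (dyadic_round n t) w @[n --> \oo] --> X t w).
Proof.
move=> PP0 t01.
pose F n w := increment_moment (dyadic_round n t) t w.
exists [set w | (\sum_(0 <= n <oo) (F n w)%:E = +oo)%E].
  have de0 : 0 < d%:R + eps by rewrite ltr_wpDl.
  apply: (polar_geometric_series PP0 _ _ _ _ _
    (fun n => dyadic_round_increment n t01)).
  - by move=> n; apply: measurable_increment_moment => //; exact: grid_point_cube.
  - by move=> n w; exact: increment_moment_ge0.
  - by rewrite mulr_ge0 ?powR_ge0 ?(ltW C_gt0).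
  - by rewrite powR_gt0 ?invr_gt0.
  - exact: powR_half_lt1.
move=> w /= /eqP; rewrite -ltey => Fw.
have F0 n : 0 <= F n w by exact: increment_moment_ge0.
have cvgF : F n w @[n --> \oo] --> 0.
  by apply: cvg_series_cvg_0; exact: nnseries_is_cvg.
apply/cvgrPdist_le => e e0.
have ep0 : 0 < e `^ p by rewrite powR_gt0.
have [m _ mP] := cvgr0_norm_le _ cvgF _ ep0.
exists m => // n /= /mP/=; rewrite ger0_norm// => Fe.
rewrite leNgt; apply/negP => lte.
have := gt0_ltr_powR p_gt0; move=> /(_ e _ _ _ lte).
rewrite !nnegrE (ltW e0) normr_ge0 => /(_ isT isT).
by rewrite ltNge Fe.
Qed.

End neighbour_moments.

(** * Construction of the modification and its properties *)

Unset Implicit Arguments.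
Set Strict Implicit.

Theorem theorem36 (R : realType) (Omega : completeMetricType R)
  (Omega_separable : separable Omega)
  (PP : set (probability (borel Omega) R)) (PP_neq0 : PP !=set0)
  (d : nat) (d_gt0 : (0 < d)%N) (p : R) (p_gt0 : 0 < p)
  (X : 'rV[R]_d -> Omega -> R)
  (X_Lp : forall t, unit_cube t -> Lp PP p (X t))
  (C eps : R) (C_gt0 : 0 < C) (eps_gt0 : 0 < eps)
  (X_moment : forall s t, unit_cube s -> unit_cube t ->
    (upper_expectation PP (fun w => (`|X t w - X s w| `^ p)%R%:E)
       <= (C * enorm (t - s) `^ (d%:R + eps))%R%:E)%E) :
  exists Y : 'rV[R]_d -> Omega -> R,
    [/\
        forall t, unit_cube t ->
          measurable_fun [set: borel Omega] (Y t) /\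
          qs PP (fun w => Y t w = X t w),
        forall a : R, 0 <= a < eps / p ->
          measurable_fun [set: borel Omega]
            (fun w => holder_quotient_sup a (Y ^~ w)) /\
          (upper_expectation PP
             (fun w => poweR (holder_quotient_sup a (Y ^~ w)) p) < +oo)%E,
        exists2 N : set (borel Omega), polar PP N &
          forall w, ~ N w -> forall a : R, a < eps / p ->
            holder_on_cube a (Y ^~ w) &
        (forall t, unit_cube t -> Lpc PP p (X t)) ->
          forall t, unit_cube t -> Lpc PP p (Y t)].
Proof.
have mX t (t01 : unit_cube t) : measurable_fun [set: borel Omega] (X t).
  by case: (X_Lp t t01).
pose T := @total_moment R Omega d X p.
pose b_ k : R := eps / p - k.+1%:R^-1.
have b_lt k : b_ k < eps / p by rewrite ltrBlDr ltrDl invr_gt0.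
have b_gt a : a < eps / p -> exists k, a < b_ k.
  by move=> /ltr_add_invr[k ak]; exists k; rewrite ltrBrDr.
pose N : set (borel Omega) := \bigcup_k [set w | T (b_ k) w = +oo%E].
have polarN : polar PP N.
  by apply: polar_bigcup => // k; apply: (polar_total_moment _ _ eps_gt0 _ X_moment).
have [mN _] := polarN.
(* b_ k increases to eps / p, so N collects the bad points of all exponents;
   early b_ k may be negative, which is harmless. *)
pose Y t : borel Omega -> R :=
  fun w => \1_(~` N) w * limn (fun n => X (dyadic_round n t) w).
have YN w t : N w -> Y t w = 0.
  by move=> Nw; rewrite /Y indicE memNset ?mul0r// => /(_ Nw).
have YNC w t : ~ N w -> Y t w = limn (fun n => X (dyadic_round n t) w).
  by move=> Nw; rewrite /Y indicE mem_set ?mul1r.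
(* The Hölder constant splits into a random factor [A k], whose p-th power is the total moment
   outside N, and a deterministic factor [c k] from [chaining_holder]. *)
pose A k w : R := (fine (T (b_ k) w)) `^ p^-1.
pose c k : R := (1 + 2 / (1 - 2^-1 `^ b_ k)) / 2^-1 `^ b_ k.
have c_ge0 k : 0 < b_ k -> 0 <= c k.
  move=> /powR_half_lt1 r1; have := powR_ge0 (2^-1) (b_ k).
  by move=> r0; rewrite divr_ge0// addr_ge0// divr_ge0//; lra.
have A_ge0 k w : 0 <= A k w by exact: powR_ge0.
have Y_holder k a w : ~ N w -> 0 < b_ k -> a <= b_ k ->
    forall s t, unit_cube s -> unit_cube t ->
    `|Y t w - Y s w| <= c k * A k w * d%:R `^ (b_ k - a) * enorm (t - s) `^ a.
  move=> Nw bk0 abk s t s01 t01.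
  apply: holder_le_exponent => //; first by rewrite mulr_ge0// c_ge0.
  rewrite !YNC//; apply: (@chaining_holder _ _ (X ^~ w)) => //.
  apply: (neighbour_increment_le p_gt0) => Tw.
  by apply: Nw; exists k.
(* This holds at every w, since Y vanishes on N; [measurable_holder_quotient_sup] requires it
   everywhere. *)
have Y_dyadic w t : unit_cube t ->
    Y (dyadic_round n t) w @[n --> \oo] --> Y t w.
  have [Nw t01|Nw] := pselect (N w).
    by under eq_cvg do rewrite YN//; rewrite YN//; exact: cvg_cst.
  have [k bk0] : exists k, 0 < b_ k by apply: b_gt; rewrite divr_gt0.
  apply: (@holder_dyadic_cvg _ _ (Y ^~ w) (b_ k) (c k * A k w)) => //.
    by rewrite mulr_ge0// c_ge0.
  move=> s u s01 u01; apply: le_trans (Y_holder _ _ _ Nw bk0 (lexx _) _ _ s01 u01) _.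
  by rewrite subrr powRr0 mulr1.
have X_dyadic w t : ~ N w -> unit_cube t -> cvgn (fun n => X (dyadic_round n t) w).
  move=> Nw t01.
  have [k bk0] : exists k, 0 < b_ k by apply: b_gt; rewrite divr_gt0.
  apply: (@dyadic_round_is_cvg _ _ (X ^~ w) (A k w) (2^-1 `^ b_ k)) => //.
  - exact: powR_half_lt1.
  - apply: (neighbour_increment_le p_gt0) => Tw.
    by apply: Nw; exists k.
have mY t : unit_cube t -> measurable_fun [set: borel Omega] (Y t).
  move=> t01.
  (* The indicator is moved inside the sequence so that it converges even on N, where the values of
     X alone may diverge. *)
  apply: (@measurable_fun_cvg _ _ _ _
    (fun n => \1_(~` N) \* (X (dyadic_round n t) : borel Omega -> R))) => [n|w _].
    apply: measurable_funM; last by apply: mX; exact: grid_point_cube.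
    by apply: measurable_indic; exact: measurableC.
  have [Nw|Nw] := pselect (N w).
    rewrite YN//; under eq_cvg => n.
      by rewrite /= indicE memNset ?mul0r; [over|move/(_ Nw)].
    exact: cvg_cst.
  by apply: cvgMr; exact: X_dyadic.
have YX t : unit_cube t -> qs PP (fun w => Y t w = X t w).
  move=> t01.
  have [M polarM XM] := qs_dyadic_round_cvg p_gt0 C_gt0 eps_gt0 mX X_moment PP_neq0 t01.
  exists (N `|` M); first exact: polarU.
  move=> w /not_orP[Nw Mw]; rewrite YNC//.
  by apply/cvg_lim => //; exact: XM.
have m_pow (Z W : borel Omega -> R) : measurable_fun [set: borel Omega] Z ->
    measurable_fun [set: borel Omega] W ->
    measurable_fun [set: borel Omega] (fun w => (`|Z w - W w| `^ p)%:E).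
  move=> mZ mW; apply/measurable_EFinP; apply: (measurableT_comp (measurable_powR p)).
  by apply: measurableT_comp => //; exact: measurable_funB.
exists Y; split.
- by move=> t t01; split; [exact: mY|exact: YX].
- move=> a /andP[a0 ap].
  have mH := measurable_holder_quotient_sup a mY Y_dyadic.
  split=> //.
  (* An exponent strictly between [a] and eps / p: the p-th power of the quotient is dominated by
     K^p times the total moment at [b_ k], whose upper expectation is finite. *)
  have [k abk] := b_gt _ ap.
  have bk0 : 0 < b_ k by exact: le_lt_trans abk.
  pose K := c k * d%:R `^ (b_ k - a).
  have K0 : 0 <= K by rewrite mulr_ge0 ?powR_ge0 ?c_ge0.
  have T0 w : (0 <= T (b_ k) w)%E by exact: total_moment_ge0.
  apply: (@le_lt_trans _ _ ((K `^ p)%:E * upper_expectation PP (T (b_ k)))%E); last first.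
    apply: lte_mul_pinfty; rewrite ?lee_fin ?powR_ge0//.
    exact: (total_moment_expectation p_gt0 C_gt0 eps_gt0 mX X_moment).
  apply/upper_expectation_leP => P PPP.
  have mT : measurable_fun [set: borel Omega] (T (b_ k)).
    exact: measurable_total_moment.
  apply: (@le_trans _ _ (\int[P]_w ((K `^ p)%:E * T (b_ k) w))%E); last first.
    rewrite ge0_integralZl//; last by rewrite lee_fin powR_ge0.
    apply: lee_wpmul2l; first by rewrite lee_fin powR_ge0.
    by move: P PPP; apply/upper_expectation_leP.
  apply: ge0_le_integral => //.
  + by move=> w _; exact: poweR_ge0.
  + exact: (measurableT_comp (measurable_poweR p)).
  + exact: measurable_funeM.
  move=> w _.
  have H0 := holder_quotient_sup_ge0 (Y ^~ w) a d_gt0.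
  have [Nw|Nw] := pselect (N w).
    (* On N the path is constant, so with [H0] the supremum is exactly 0 and the domination holds
       there too. *)
    have H1 : (holder_quotient_sup a (Y ^~ w) <= 0%:E)%E.
      by apply: holder_quotient_sup_le => s t _ _; rewrite !YN// subrr normr0 mul0r.
    have -> : holder_quotient_sup a (Y ^~ w) = 0%:E by apply/eqP; rewrite eq_le H1.
    rewrite poweR_EFin powR0 ?gt_eqF// mule_ge0// lee_fin powR_ge0//.
  have Tfin : T (b_ k) w \is a fin_num.
    by rewrite ge0_fin_numE// ltey; apply/eqP => Tw; apply: Nw; exists k.
  have H1 : (holder_quotient_sup a (Y ^~ w) <= (K * A k w)%:E)%E.
    apply: holder_quotient_sup_le => s t s01 t01.
    by rewrite /K [c k * _ * _]mulrAC; apply: Y_holder => //; exact: ltW.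
  apply: (@le_trans _ _ (((K * A k w)%:E) `^ p)%E).
    apply: gt0_ler_poweR => //; first exact: ltW.
      by rewrite in_itv/= H0 leey.
    by rewrite in_itv/= leey andbT (le_trans H0).
  rewrite poweR_EFin powRM// -powRrM mulVf ?gt_eqF// powRr1 ?fine_ge0//.
  by rewrite EFinM fineK.
- exists N => // w Nw a ap.
  (* Here [a] may be negative, while chaining needs [b_ k] positive; hence the maximum with 0. *)
  have [k] : exists k, Num.max a 0 < b_ k.
    by apply: b_gt; rewrite gt_max ap divr_gt0.
  rewrite gt_max => /andP[abk bk0].
  exists (c k * A k w * d%:R `^ (b_ k - a)) => s t s01 t01.
  by apply: Y_holder => //; exact: ltW.
- move=> X_Lpc t t01; have [[_ XLp] Xapprox] := X_Lpc t t01.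
  have [M polarM YXM] := YX t t01.
  (* Y_t and X_t are at the same distance from every Borel Z. Z = 0 yields membership in [Lp], and Z
     = f carries over each approximation by bounded continuous functions. *)
  have Eeq (Z : borel Omega -> R) : measurable_fun [set: borel Omega] Z ->
      upper_expectation PP (fun w => (`|Y t w - Z w| `^ p)%:E) =
      upper_expectation PP (fun w => (`|X t w - Z w| `^ p)%:E).
    move=> mZ; apply: (qs_upper_expectation PP_neq0).
    + by apply: m_pow => //; exact: mY.
    + by apply: m_pow => //; exact: mX.
    + by move=> w; rewrite lee_fin powR_ge0.
    + by move=> w; rewrite lee_fin powR_ge0.
    + by exists M => // w /YXM ->.
  split.
    split; first exact: mY.
    have := Eeq (cst 0) (measurable_cst _).
    under eq_fun do rewrite subr0.
    by under [in X in _ = X -> _]eq_fun do rewrite subr0; move=> ->.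
  move=> e e0; have [f Cbf fe] := Xapprox e e0; exists f; first exact: Cbf.
  have mf : measurable_fun [set: borel Omega] f.
    by case: Cbf => /measurable_continuous.
  by move: fe; rewrite /Lp_dist (Eeq f mf).
Qed.
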